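(* Let $d\ge1$. Every $d$-regular graph $G$ with $n$ vertices contains a spanning subgraph $H$ satisfying $m(H)\le 8\frac{n}{d}+2$.
   Context: All graphs are finite and simple. For a graph $G$ and an integer $k\ge 0$, $m(G,k)$ denotes the number of vertices of degree exactly $k$ in $G$, and $m(G)=\max_k m(G,k)$. A spanning subgraph of $G$ is a subgraph with the same vertex set as $G$. *)

(* Defs.v *)
From mathcomp Require Import all_boot.
Set Implicit Arguments. Unset Strict Implicit. Unset Printing Implicit Defensive.

Definition simple_graph (T : finType) (e : rel T) : Prop :=
  symmetric e /\ irreflexive e.

Definition deg (T : finType) (e : rel T) (x : T) : nat := #|[set y | e x y]|.

Definition regular (T : finType) (e : rel T) (d : nat) : Prop :=
  forall x, deg e x = d.

Definition spanning_subgraph (T : finType) (h e : rel T) : Prop :=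
  simple_graph h /\ subrel h e.

Definition mult (T : finType) (e : rel T) (k : nat) : nat :=
  #|[set x | deg e x == k]|.

(* m(G) = max_k m(G,k); degrees are < #|T|, so m(G,k) = 0 for k >= #|T|,
   hence the max over k <= #|T| is the max over all k. *)
Definition maxmult (T : finType) (e : rel T) : nat :=
  \max_(k < #|T|.+1) mult e k.

(* Main.v *)
(* Give the edges weights in {0,1/3,2/3,1} (stored below times 3) so that every
   weighted degree lies strictly between j and j+1 for some integer j, each j
   being shared by few vertices.  The vertices are processed one at a time in the
   manner of Kalkowski, Karonski and Pfender; each of them has at least (d+1)/3
   candidates for j, so the least used one serves few vertices.  Because the
   weighted degrees are never integers, an alternating-path argument rounds the
   weights to 0/1 with each degree equal to j or j+1.  Hence a degree k only
   comes from j = k or j = k-1. *)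
Require Import Defs.
From mathcomp Require Import all_boot all_order all_algebra.
From mathcomp Require Import zify.
Set Implicit Arguments. Unset Strict Implicit. Unset Printing Implicit Defensive.
Import Order.TTheory GRing.Theory Num.Theory.

(** * Degrees and edge toggling *)

Lemma degE (T : finType) (h : rel T) (x : T) : deg h x = \sum_y h x y.
Proof.
by rewrite /deg -sum1dep_card big_mkcond; apply: eq_bigr => y _; case: (h x y).
Qed.

Definition wdeg (T : finType) (w : T -> T -> nat) (x : T) : nat := \sum_y w x y.

Definition toggle (T : eqType) (h : rel T) (u v : T) : rel T :=
  fun a b => h a b (+) ((a == u) && (b == v) || (a == v) && (b == u)).

Local Open Scope ring_scope.

Definition sgb (b : bool) : int := if b then 1 else -1.

Lemma toggle_sym (T : eqType) (h : rel T) (u v : T) :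
  symmetric h -> symmetric (toggle h u v).
Proof.
by move=> hs a b; rewrite /toggle hs orbC [(b == u) && _]andbC [(b == v) && _]andbC.
Qed.

Lemma deg_toggle (T : finType) (h : rel T) (u v z : T) :
  symmetric h -> u != v ->
  (deg (toggle h u v) z)%:Z =
    (deg h z)%:Z - sgb (h u v) *+ (z == u) - sgb (h u v) *+ (z == v).
Proof.
move=> hs uv; rewrite !degE.
have key a b : a != b -> (\sum_y toggle h a b a y)%:Z =
    (\sum_y h a y)%:Z - sgb (h a b).
  move=> ab; rewrite (bigD1 b) // [in RHS](bigD1 b) //=.
  rewrite (eq_bigr (fun y => h a y : nat)); last first.
    by move=> y yb; rewrite /toggle (negbTE yb) (negbTE ab) andbF andFb addbF.
  by rewrite /toggle !eqxx /=; case: (h a b) => /=; rewrite /sgb; lia.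
have [->|zu] := eqVneq z u.
  by rewrite (negbTE uv) /= key // subr0.
have [->|zv] := eqVneq z v; last first.
  rewrite !subr0; congr Posz; apply: eq_bigr => y _.
  by rewrite /toggle (negbTE zu) (negbTE zv) addbF.
rewrite (hs u v) /= subr0 -key 1?eq_sym //; congr Posz; apply: eq_bigr => y _.
by rewrite /toggle orbC.
Qed.

(** * Augmentation along alternating paths *)

Section Augment.
Variables (T : finType) (g : rel T) (tau : T -> bool).
Hypothesis g_irr : irreflexive g.
Hypothesis g_sym : symmetric g.

Definition togglable (h : rel T) : rel T := fun a b => g a b && (h a b == tau a).

(* tau x says whether the degree of x is to be lowered; passing through a vertex
   of an altstep path leaves its degree unchanged. *)
Definition altstep (h : rel T) : rel T :=
  fun a b => togglable h a b && (tau b != tau a).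

(** The only risk is the toggled edge read backwards, [a = v] and [b = u]. But [h u v] equals
    [tau u], which differs from [tau v], so that edge was not togglable from [v]. *)
Lemma togglable_toggle (h : rel T) (u v a b : T) :
  symmetric h -> altstep h u v -> a != u -> togglable h a b ->
  togglable (toggle h u v) a b.
Proof.
move=> hs /andP[/andP[guv /eqP huv] tauv] au /andP[gab /eqP hab].
rewrite /togglable gab /= /toggle (negbTE au) /=.
have [eab|_] := boolP (_ && _); last by rewrite addbF hab.
case/andP: eab => /eqP ea /eqP eb; subst a b.
by move: tauv; rewrite -hab hs huv eqxx.
Qed.

(* No edge is toggled twice: the path is simple, and two traversals of an edge
   in opposite directions would need opposite values of h on it. *)
Lemma augment (h : rel T) (u v : T) (p : seq T) :
  symmetric h -> subrel h g ->
  path (altstep h) u p -> uniq (u :: p) ->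
  togglable h (last u p) v -> tau v = tau (last u p) ->
  exists h' : rel T, [/\ symmetric h', subrel h' g &
    forall z, (deg h' z)%:Z =
      (deg h z)%:Z - sgb (tau u) *+ (z == u) - sgb (tau v) *+ (z == v)].
Proof.
have sub_toggle (k : rel T) a b : subrel k g -> g a b -> subrel (toggle k a b) g.
  move=> sk gab x y; rewrite /toggle.
  case: (boolP (_ || _)) => [/orP[] /andP[/eqP-> /eqP->] _ //|_].
    by rewrite g_sym.
  by rewrite addbF; apply: sk.
have neq a b : g a b -> a != b.
  by move=> gab; apply/eqP => ab; rewrite ab g_irr in gab.
elim: p h u => [|x p IH] h u hs hg /=.
  move=> _ _ /andP[guv /eqP huv] tuv.
  exists (toggle h u v); split; [exact: toggle_sym|exact: sub_toggle|move=> z].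
  by rewrite deg_toggle ?neq // huv tuv.
case/andP=> sux pth /andP[nu uq] tgl tv.
have [/andP[gux /eqP hux] tux] := andP sux.
have pth' : path (altstep (toggle h u x)) x p.
  have pu : all (predC1 u) (x :: p).
    by apply/allP => y yp; apply: contraNneq nu => <-.
  apply: sub_in_path pu pth => a b ain bin; rewrite /altstep => /andP[tab ->].
  by rewrite andbT togglable_toggle.
have tgl' : togglable (toggle h u x) (last x p) v.
  by apply: togglable_toggle => //; apply: contraNneq nu => <-; apply: mem_last.
have [k [ks kg kdeg]] := IH _ x (toggle_sym u x hs) (sub_toggle _ _ _ hg gux)
  pth' uq tgl' tv.
exists k; split=> // z; rewrite kdeg deg_toggle ?neq // hux.
(* The toggle and the rest of the path change the degree of [x] in opposite directions, as [tau]
   alternates. *)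
have -> : sgb (tau x) = - sgb (tau u) by move: tux; case: (tau u); case: (tau x).
by rewrite mulNrn opprK subrK.
Qed.

End Augment.

(** * Rounding the weights *)

Section Round.
Variables (T : finType) (w : T -> T -> nat) (q : nat) (j : T -> nat).
Hypothesis w_sym : forall x y, w x y = w y x.
Hypothesis w_irr : forall x, w x x = 0%N.
Hypothesis w_le : forall x y, (w x y <= q)%N.
Hypothesis w_bnd : forall x, (q * j x < wdeg w x < q * (j x).+1)%N.

Let supp : rel T := fun x y => (0 < w x y)%N.
(** By [w_bnd], this holds exactly when [q * deg h x] exceeds [wdeg w x]. *)
Let over (h : rel T) x := (j x < deg h x)%N.

(** Total distance of the degrees from the intervals [j x, j x + 1], as subtraction truncates at 0;
    the rounding drives this potential to 0. *)
Definition dev (h : rel T) : nat :=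
  (\sum_x ((deg h x - (j x).+1) + (j x - deg h x)))%N.

(** For [h] inside [supp], these are the pairs where [q * h x y] errs from [w x y] in the same
    direction as [q * deg h x] errs from [wdeg w x]. *)
Let slack (h : rel T) : rel T :=
  fun x y => togglable supp (over h) h x y && (over h x ==> (w x y < q)%N).

(* Raising the degree of a vertex that is not over, or lowering that of one that
   is, does not increase dev, so y may end an alternating path.  If there were no
   such y, the set R of reachable vertices would satisfy
   sum_(x in R) +/- (q * deg h x - wdeg w x) <= 0 with all summands positive. *)
Lemma exists_terminal (h : rel T) (v : T) :
  symmetric h -> subrel h supp ->
  exists x y, [/\ connect (fun a b => slack h a b && (over h b != over h a)) v x,
    slack h x y & over h y = over h x].
Proof.
move=> hs hw; set r := (X in connect X).
suff [x /existsP[y /and3P[xR sxy /eqP oxy]]] :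
    exists x, [exists y, [&& connect r v x, slack h x y & over h y == over h x]].
  by exists x, y.
apply/existsP; apply: contraT; rewrite negb_exists => /forallP no.
have closed x y : connect r v x -> slack h x y ->
    connect r v y /\ over h y != over h x.
  move=> vx sxy; have oxy : over h y != over h x.
    apply/negP => oxy; have /negP := no x; apply; apply/existsP; exists y.
    by rewrite vx sxy.
  by split=> //; apply: connect_trans vx _; apply: connect1; rewrite /r sxy.
pose F x y : int := sgb (over h x) * ((q * h x y)%:Z - (w x y)%:Z).
have F_le0 x y : ~~ slack h x y -> F x y <= 0.
  rewrite /slack /togglable /F /supp; have := w_le x y; have := hw x y.
  by rewrite /supp; case: (h x y); case: (over h x) => /=; rewrite /sgb; lia.
pose R := connect r v.
have sumF x : \sum_y F x y =
    sgb (over h x) * ((q * deg h x)%:Z - (wdeg w x)%:Z).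
  rewrite -big_distrr /= sumrB degE /wdeg big_distrr /=.
  by rewrite !(big_morph Posz PoszD (erefl 0%:Z)).
have pos x : 0 < \sum_y F x y.
  rewrite sumF; have := w_bnd x; rewrite /over /sgb.
  by case: (ltnP (j x)) => jd; have := leq_mul (leqnn q) jd; lia.
have : 0 < \sum_(x | R x) \sum_y F x y.
  rewrite (bigD1 v) ?[R v]connect0 //=; apply: ltr_pwDl => //.
  by apply: sumr_ge0 => x _; apply: ltW.
have -> : \sum_(x | R x) \sum_y F x y =
    \sum_(x | R x) \sum_(y | R y) F x y + \sum_(x | R x) \sum_(y | ~~ R y) F x y.
  by rewrite -big_split /=; apply: eq_bigr => x _; rewrite [LHS](bigID R).
have out : \sum_(x | R x) \sum_(y | ~~ R y) F x y <= 0.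
  apply: sumr_le0 => x xR; apply: sumr_le0 => y yR; apply: F_le0.
  by apply: contra yR => /(closed _ _ xR)[].
(* If [over] differs at the two ends, the terms cancel by symmetry of [h] and [w]. If it agrees,
   [closed] shows that neither direction is slack, so both terms are at most 0. *)
have : \sum_(x | R x) \sum_(y | R y) (F x y + F y x) <= 0.
  apply: sumr_le0 => x xR; apply: sumr_le0 => y yR.
  have [oxy|oxy] := eqVneq (over h y) (over h x); last first.
    rewrite /F (w_sym y x) (hs y x); move: oxy.
    by rewrite /sgb; case: (over h y); case: (over h x) => // _; lia.
  have le a b : R a -> over h b = over h a -> F a b <= 0.
    move=> aR ab; apply: F_le0; apply/negP => /(closed _ _ aR)[_].
    by rewrite ab eqxx.
  by have := le x y xR oxy; have := le y x yR (esym oxy); lia.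
under eq_bigr => x _ do rewrite big_split /=.
rewrite big_split /= [X in _ + X <= 0]exchange_big /=.
rewrite -mulr2n pmulrn_lle0 // => ins.
by rewrite ltNge => /negP[]; rewrite -[leRHS]addr0 lerD.
Qed.

Lemma improve (h : rel T) :
  symmetric h -> subrel h supp -> (0 < dev h)%N ->
  exists h' : rel T, [/\ symmetric h', subrel h' supp & (dev h' < dev h)%N].
Proof.
move=> hs hw; rewrite lt0n /dev sum_nat_eq0 negb_forall => /existsP[v /= dv].
have [x [y [/connectP[p0 pth0 lx0] /andP[txy _] oxy]]] := exists_terminal v hs hw.
move: lx0; case/shortenP: pth0 => p pth up _ lx; subst x.
have supp_irr : irreflexive supp by move=> z; rewrite /supp w_irr.
have supp_sym : symmetric supp by move=> a b; rewrite /supp w_sym.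
have pth' : path (altstep supp (over h) h) v p.
  by apply: sub_path pth => a b /andP[/andP[tab _] oab]; rewrite /altstep tab.
have [k [ks kw kdeg]] := augment supp_irr supp_sym hs hw pth' up txy oxy.
exists k; split=> //.
rewrite /dev (bigD1 v) //= [ltnRHS](bigD1 v) //=.
(* If [y = v], the degree of [v] moves by two. A wrong degree is at least j + 2 or at most j - 1, so
   it still does not overshoot the interval. *)
have lev z : (deg k z - (j z).+1 + (j z - deg k z) <=
              deg h z - (j z).+1 + (j z - deg h z) - (z == v))%N.
  have dvz : z == v -> (deg h z - (j z).+1 + (j z - deg h z))%N != 0%N
    by move/eqP->.
  have ovz : z == v -> over h v = (j z < deg h z)%N by move/eqP->.
  have oyz : z == y -> over h y = (j z < deg h z)%N by move/eqP->.
  move: dvz ovz oyz (kdeg z); move: (deg h z) (deg k z) (j z) => dh dk jz.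
  case: (z == v); case: (z == y) => dvz ovz oyz; rewrite ?mulr1n ?mulr0n ?subr0;
    rewrite ?ovz ?oyz // /sgb; clear -dvz; case: (ltnP jz dh); lia.
rewrite -addSn leq_add //.
  by have := lev v; rewrite eqxx; lia.
by apply: leq_sum => z zv; have := lev z; rewrite (negbTE zv) subn0.
Qed.

Lemma round_weights :
  exists h : rel T, [/\ symmetric h, subrel h supp &
    forall x, (j x <= deg h x <= (j x).+1)%N].
Proof.
suff H n (h : rel T) : symmetric h -> subrel h supp -> (dev h <= n)%N ->
    exists k : rel T, [/\ symmetric k, subrel k supp & dev k = 0%N].
  have [|//||k [ks kw /eqP]] := H (dev (fun _ _ => false)) (fun _ _ => false) => //.
  rewrite /dev sum_nat_eq0 => /forallP k0; exists k; split=> // x.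
  by have := k0 x => /=; lia.
elim: n h => [|n IH] h hs hw hn.
  by exists h; split=> //; apply/eqP; rewrite -leqn0.
have [h0|h0] := posnP (dev h); first by exists h.
have [k [ks kw kh]] := improve hs hw h0.
by apply: (IH k) => //; rewrite -ltnS; apply: leq_trans kh hn.
Qed.

End Round.

Local Open Scope nat_scope.

(** * Constructing the weights *)

Lemma free_slot (T : eqType) (s : seq T) (j : T -> nat) (j0 K c : nat) :
  size s < K * c -> exists2 i, i < K & count (fun x => j x == j0 + i) s < c.
Proof.
move=> sz; have [/allP full|/allPn[i]] := boolP
    (all (fun i => c <= count (fun x => j x == j0 + i) s) (iota 0 K)).
- have : K * c <= count (fun x => j0 <= j x < j0 + K) s.
    have : forall i, i < K -> c <= count (fun x => j x == j0 + i) s.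
      by move=> i iK; apply: full; rewrite mem_iota.
    elim: K {sz full} => [|K IH] full; first by rewrite mul0n.
    have -> : count (fun x => j0 <= j x < j0 + K.+1) s =
        count (fun x => j0 <= j x < j0 + K) s + count (fun x => j x == j0 + K) s.
      by elim: s {IH full} => //= x s ->; lia.
    by rewrite mulSn addnC leq_add ?full // IH // => i iK; apply: full; lia.
  by have := count_size (fun x => j0 <= j x < j0 + K) s; lia.
- by rewrite mem_iota -ltnNge => iK ci; exists i.
Qed.

Lemma exists_subset_card (T : finType) (A : {set T}) (t : nat) :
  t <= #|A| -> exists2 Z : {set T}, Z \subset A & #|Z| = t.
Proof.
move=> tA; exists [set x in take t (enum A)].
  by apply/subsetP => x; rewrite inE => /mem_take; rewrite mem_enum.
rewrite cardsE (card_uniqP _) ?take_uniq ?enum_uniq //.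
by rewrite size_take -cardE; case: ltnP => //; lia.
Qed.

Section Weights.
Variables (T : finType) (e : rel T) (d c : nat).
Hypothesis e_sym : symmetric e.
Hypothesis e_irr : irreflexive e.
Hypothesis e_reg : regular e d.
Hypothesis c_big : #|T| < d.+1 %/ 3 * c.

Definition slot_ok (w : T -> T -> nat) (j : T -> nat) (x : T) : bool :=
  3 * j x < wdeg w x < 3 * (j x).+1.

(** Invariant once [s] is processed. An edge weighs 1 while both ends are unprocessed, and 1 or 2
    once one end is processed; this leaves room in 0..3 for a change of 1 at its second end. *)
Definition weighting (s : seq T) (w : T -> T -> nat) (j : T -> nat) : Prop :=
  [/\ forall x y, w x y = w y x,
      forall x y, w x y <= 3 * e x y,
      forall x y, e x y -> y \notin s -> 1 <= w x y <= 1 + (x \in s),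
      forall x, x \in s -> slot_ok w j x &
      forall k, count (fun x => j x == k) s <= c].

(* An edge is changed by +0/+1 when its first endpoint is processed, and then
   by +/-1 when the second one is, with the sign that keeps the first endpoint in
   its slot {3j+1, 3j+2}.  Thus d+1 consecutive values are available at v. *)
Lemma weighting_cons (s : seq T) (v : T) (w : T -> T -> nat) (j : T -> nat) :
  uniq (v :: s) -> weighting s w j -> exists w' j', weighting (v :: s) w' j'.
Proof.
move=> /= /andP[vs us] [ws we w1 wj jc].
(* The smaller of the two weights allowed on the edge: a processed [y] at the top of its slot can
   only lose 1, any other neighbour can only gain 1. *)
pose lo y := w v y - [&& e v y, y \in s & wdeg w y == 3 * j y + 2].
pose L := \sum_y lo y.
(* The least j with L <= 3j + 1. As 3 * j0 <= L + 1 and 3 * i <= d - 2 for every slot [i], the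
   target 3 * (j0 + i) + 1 lies in L..L + d. *)
pose j0 := (L + 1) %/ 3.
have szs : size s <= #|T| by rewrite -(card_uniqP us) max_card.
have [i iK ci] := free_slot j j0 (leq_ltn_trans szs c_big).
pose t := 3 * (j0 + i) + 1 - L.
have [tL td] : L + t = 3 * (j0 + i) + 1 /\ t <= d by rewrite /t /j0; lia.
have [|Z ZN Zt] := @exists_subset_card _ [set y | e v y] t.
  by rewrite (_ : #|_| = d) //; apply: e_reg.
have Ze y : y \in Z -> e v y by move/(subsetP ZN); rewrite inE.
pose nw y := lo y + (y \in Z).
pose w' a b := if a == v then nw b else if b == v then nw a else w a b.
pose j' x := if x == v then j0 + i else j x.
have v_nb y : e v y -> y != v by move=> evy; apply/eqP => yv; rewrite yv e_irr in evy.
have nw0 y : ~~ e v y -> nw y = 0.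
  move=> nev; rewrite /nw /lo; have := we v y; rewrite (negbTE nev).
  by rewrite (contraNF (@Ze y) nev); lia.
have w'v : wdeg w' v = 3 * (j0 + i) + 1.
  rewrite /wdeg /w' eqxx big_split /= -/L -tL -Zt -sum1_card; congr (_ + _).
  by rewrite [RHS]big_mkcond; apply: eq_bigr => y _; case: (_ \in _).
have w'n y : y != v -> wdeg w' y + w v y = wdeg w y + nw y.
  move=> yv; rewrite /wdeg (bigD1 v) //= [in RHS](bigD1 v) //= /w' (negbTE yv) eqxx.
  rewrite (eq_bigr (w y)); last by move=> b /negbTE->.
  by rewrite (ws v y); lia.
exists w', j'; split.
- move=> a b; rewrite /w'.
  by have [av|_] := eqVneq a v; have [bv|_] := eqVneq b v; rewrite ?av ?bv.
- have le y : nw y <= 3 * e v y.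
    have [evy|nev] := boolP (e v y); last by rewrite nw0.
    have := w1 y v; rewrite e_sym evy => /(_ isT vs); rewrite (ws y v) /nw /lo.
    by lia.
  move=> a b; rewrite /w'; case: eqVneq => [->|av]; first exact: le.
  by case: eqVneq => [->|bv]; rewrite ?we // e_sym le.
- move=> a b eab; rewrite !inE negb_or => /andP[bv bs]; rewrite /w' (negbTE bv).
  case: eqVneq => [av|av]; last exact: w1.
  have := w1 a b eab bs; rewrite av (negbTE vs) /nw /lo (negbTE bs) andbF /=.
  lia.
- move=> x; rewrite inE /slot_ok /j'; case: eqVneq => [-> _|xv /= xs].
    by rewrite w'v; lia.
  have := w'n x xv; have := wj x xs; rewrite /slot_ok.
  have [evx|nev] := boolP (e v x); last first.
    by have := we v x; rewrite nw0 // (negbTE nev); lia.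
  have := w1 x v; rewrite e_sym evx => /(_ isT vs); rewrite (ws x v).
  by rewrite /nw /lo evx xs /=; lia.
- move=> k /=; rewrite /j' eqxx.
  have -> : count (fun x => (if x == v then j0 + i else j x) == k) s =
      count (fun x => j x == k) s.
    apply: eq_in_count => x xs; case: (eqVneq x v) => // xv.
    by rewrite -xv xs in vs.
  have [<-|_] := eqVneq (j0 + i) k; last exact: jc.
  by rewrite add1n.
Qed.

Lemma exists_weighting : exists w j, weighting (enum T) w j.
Proof.
elim: (enum T) (enum_uniq T) => [_|v s IH us]; last first.
  have [w [j wj]] := IH (subseq_uniq (subseq_cons s v) us).
  exact: weighting_cons us wj.
(* Every edge starts with weight one third, stored as 1. *)
exists (fun x y => e x y : nat), (fun=> 0); split=> //.
- by move=> x y; rewrite e_sym.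
- by move=> x y; lia.
- by move=> x y ->.
Qed.

End Weights.

(** * From weights to the bound on multiplicities *)

Lemma maxmult_le (T : finType) (e : rel T) (d c : nat) :
  simple_graph e -> regular e d -> #|T| < d.+1 %/ 3 * c ->
  exists h : rel T, spanning_subgraph h e /\ maxmult h <= 2 * c.
Proof.
move=> [es ei] er cT.
have [w [j [ws we _ wj jc]]] := exists_weighting es ei er cT.
have [|||h [hs hw hj]] := @round_weights T w 3 j ws.
- by move=> x; apply/eqP; rewrite -leqn0; have := we x x; rewrite ei.
- by move=> x y; apply: leq_trans (we x y) _; case: (e x y).
- by move=> x; apply: wj; rewrite mem_enum.
have he : subrel h e.
  by move=> x y /hw; have := we x y; case: (e x y) => //; lia.
exists h; split.
  by split=> //; split=> // x; apply/negP => /he; rewrite ei.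
apply/bigmax_leqP => k _; rewrite /mult.
have jcard m : #|[set x | j x == m]| <= c.
  rewrite cardE /enum_mem size_filter -enumT; apply: leq_trans (jc m).
  by apply: sub_count => x /=; rewrite inE.
apply: (@leq_trans #|[set x | j x == k] :|: [set x | j x == k.-1]|); last first.
  rewrite cardsU; have := jcard k; have := jcard k.-1; lia.
by apply: subset_leq_card; apply/subsetP => x; rewrite !inE; have := hj x; lia.
Qed.

Local Open Scope ring_scope.

Theorem theorem1p5 (T : finType) (e : rel T) (d : nat) :
  (1 <= d)%N -> simple_graph e -> regular e d ->
  exists h : rel T, spanning_subgraph h e /\
    ((maxmult h)%:R <= 8%:R * (#|T|%:R / d%:R) + 2%:R :> rat).
Proof.
move=> d1 eg er.
suff [h [he hm]] : exists h : rel T, spanning_subgraph h e /\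
    (d * maxmult h <= 8 * #|T| + 2 * d)%N.
  exists h; split=> //; have d0 : 0 < d%:R :> rat by rewrite ltr0n.
  rewrite -(ler_pM2l d0) mulrDr mulrCA [d%:R * (_ / _)]mulrCA divff ?gt_eqF //.
  by rewrite mulr1 mulrC -!natrM -natrD ler_nat mulnC [(d * 2)%N]mulnC.
(* For d <= 8 the graph itself serves, since 8n/d >= n. *)
have [d8|d8] := leqP d 8.
  exists e; split; first by split.
  apply: leq_trans (leq_addr _ _); apply: leq_mul => //.
  by apply/bigmax_leqP => k _; apply: max_card.
pose K := (d.+1 %/ 3)%N.
have [|h [he hm]] := @maxmult_le T e d (#|T| %/ K).+1 eg er.
  by rewrite mulnC; apply: ltn_ceil; rewrite /K; lia.
exists h; split=> //.
apply: leq_trans (leq_mul (leqnn d) hm) _.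
(* With c = n %/ K + 1, d * 2c = 2d + 2d * (n %/ K), and d <= 4K bounds the last term by 8n. *)
have Kd : (d <= 4 * K)%N by rewrite /K; lia.
have := leq_mul Kd (leqnn (#|T| %/ K)); have := leq_trunc_div #|T| K; lia.
Qed.
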